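(* Suppose there exist a measurable function $V:S\to[0,\infty)$ and constants $C_0\in(0,\infty)$, $\lambda\in(0,1)$ such that (i) $\int_S V(z)\,p(x,dz)\le(1-\lambda)V(x)+C_0$ for all $x\in S$; (ii) $\lim_{r\to\infty}\inf_{d(x,y)=r}[V(x)+V(y)]=\infty$ and $\lim_{r\to\infty}\sup_{d(x,y)=r}\frac{\beta(x,y)}{V(x)+V(y)}=0$. Fix $K>0$ and let $$r_1=\sup\Big\{d(x,y):x,y\in S\text{ with }\tfrac{\beta(x,y)}{V(x)+V(y)}\ge K\text{ or }V(x)+V(y)\le\tfrac{4C_0}{\lambda}\Big\}$$ (which is finite by (ii)). Suppose that for this $r_1$ and some $r_0$ with $0<r_0\le r_1$: (a1) $\inf_{r\in(0,r_0]}\underline\pi(r)>0$; (a2) $\inf_{r\in(r_0,r_1]}\underline\alpha(r)>0$ and $\sup_{r\in(0,r_1]}\overline\beta(r)<\infty$. Define $$A=\frac{16KC_0}{\lambda\inf_{r\in(r_0,r_1]}\underline\alpha(r)},\qquad c=\sup_{r\in(r_0,r_1]}\frac{2\overline\beta(r)_+}{\underline\alpha(r)}+A+1,\qquad \epsilon=\frac1{8C_0}c^2e^{-cr_1}\inf_{r\in(r_0,r_1]}\underline\alpha(r),$$ $$a=2\Big(c\sup_{r\in(0,r_0]}\overline\beta(r)_++2\epsilon C_0\Big)\Big[\inf_{r\in(0,r_0]}\underline\pi(r)\Big]^{-1},$$ and $$\rho(x,y)=a\mathbf 1_{\{d(x,y)>0\}}+1-e^{-c\,d(x,y)}+\epsilon\,(V(x)+V(y))\mathbf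 1_{\{d(x,y)>0\}}.$$ Then there exists a constant $c_*\in(0,1)$ such that for all $x,y\in S$, $$\mathbb E_{x,y}[\rho(X,Y)]\le(1-c_* )\rho(x,y).$$
   Context: Let $(S,d)$ be a separable metric space and $p(x,dz)$ a Markov transition kernel on $S$. $((X,Y),\mathbb P_{x,y})$ is a Markov coupling of $p(x,\cdot)$ and $p(y,\cdot)$: there are random variables $X,Y:\Omega\to S$ on a common measurable space $(\Omega,\mathcal F)$ and probability measures $\mathbb P_{x,y}$ (depending on $(x,y)\in S\times S$ as a probability kernel) such that under $\mathbb P_{x,y}$, $X\sim p(x,\cdot)$ and $Y\sim p(y,\cdot)$. It is assumed that $\mathbb P_{x,x}(X=Y)=1$ for all $x\in S$. $\mathbb E_{x,y}$ is expectation under $\mathbb P_{x,y}$. For $x,y\in S$ put $\pi(x,y)=\mathbb P_{x,y}(d(X,Y)=0)$, $\beta(x,y)=\mathbb E_{x,y}[d(X,Y)-d(x,y)]$, $\alpha(x,y)=\frac12\mathbb E_{x,y}[(d(X,Y)-d(x,y))^2\mathbf 1_{\{d(X,Y)<d(x,y)\}}]$. For $r>0$ put $\underline\pi(r)=\inf_{d(x,y)=r}\pi(x,y)$, $\overline\beta(r)=\sup_{d(x,y)=r}\beta(x,y)$, $\underline\alpha(r)=\inf_{d(x,y)=r}\alpha(x,y)$, and $\overline\beta(r)_+=\max(\overline\beta(r),0)$. Conventions: values $r$ that are not attained as a distance are ignored in infima and suprema over $r$; in the formulas for $A,c,\epsilon,a$ a supremum over an empty set is read as $0$ and an infimum over an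 empty set is read as $1$ (e.g. when $r_0=r_1$). *)

(* Defs.v *)
From HB Require Import structures.
From mathcomp Require Import all_boot all_order all_algebra.
From mathcomp Require Import all_classical all_reals all_analysis.

Set Implicit Arguments.
Unset Strict Implicit.
Unset Printing Implicit Defensive.

Import Order.TTheory GRing.Theory Num.Theory.
Import numFieldNormedType.Exports.

Local Open Scope classical_set_scope.
Local Open Scope ring_scope.

(* The library's measurable types are pointed, so carrying a Borel sigma-algebra
   requires a pointed metric space, i.e. a nonempty one. *)
#[short(type="pmetricType")]
HB.structure Definition PointedMetric (K : numDomainType) :=
  { M of Metric K M & Pointed M }.

Definition separable_space (T : topologicalType) : Prop :=
  exists2 D : set T, countable D & dense D.

(* [borel S] is the carrier of S itself, so points of S are points of [borel S].
   When S is separable, the product sigma-algebra on [borel S * borel S]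
   is the Borel sigma-algebra of the product space. *)
Notation borel S := (g_sigma_algebraType (@open S)).

Section Levels.
Context {R : realType} {S : pmetricType R}.
Implicit Types (f : S -> S -> \bar R) (I : set R) (g : R -> \bar R).

Definition distances : set R := [set r | exists x y : S, mdist x y = r].

Definition level_inf f (r : R) : \bar R :=
  ereal_inf [set e | exists x y : S, mdist x y = r /\ e = f x y].

Definition level_sup f (r : R) : \bar R :=
  ereal_sup [set e | exists x y : S, mdist x y = r /\ e = f x y].

(* Infima and suprema over the attained distances in I; the empty infimum is 1
   and the empty supremum is 0. *)
Definition inf_attained I g : \bar R :=
  if `[< I `&` distances = set0 >] then 1%E
  else ereal_inf [set g r | r in I `&` distances].

Definition sup_attained I g : \bar R :=
  if `[< I `&` distances = set0 >] then 0%E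
  else ereal_sup [set g r | r in I `&` distances].

End Levels.

Arguments distances {R} S.
Arguments inf_attained {R} S I g.
Arguments sup_attained {R} S I g.

Section Coupling.
Context {R : realType} {S : pmetricType R} {d : measure_display}
  {Omega : measurableType d}.
Variables (P : R.-pker (borel S * borel S) ~> Omega)
  (X Y : {mfun Omega >-> borel S}).

Definition markov_coupling (p : R.-pker (borel S) ~> (borel S)) : Prop :=
  forall (x y : S) (B : set (borel S)), measurable B ->
    pushforward (P (x, y)) X B = p x B /\
    pushforward (P (x, y)) Y B = p y B.

Definition coupled_dist (w : Omega) : R := mdist (X w : S) (Y w : S).

Definition pi_ (x y : S) : \bar R := P (x, y) [set w | coupled_dist w = 0].

(* The integrand is bounded below by - d(x, y), so the integral is always
   meaningful, with value in ]-oo, +oo]. *)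
Definition beta (x y : S) : \bar R :=
  (\int[P (x, y)]_w (coupled_dist w - mdist x y)%R%:E)%E.

Definition alpha (x y : S) : \bar R :=
  ((2^-1)%R%:E * \int[P (x, y)]_w
     ((coupled_dist w - mdist x y) ^+ 2 *
      (coupled_dist w < mdist x y)%R%:R)%R%:E)%E.

Definition pi_low : R -> \bar R := level_inf pi_.
Definition beta_up : R -> \bar R := level_sup beta.
Definition beta_up_pos (r : R) : \bar R := maxe (beta_up r) 0%E.
Definition alpha_low : R -> \bar R := level_inf alpha.

Definition drift_ratio (V : S -> R) (x y : S) : \bar R :=
  (beta x y / (V x + V y)%R%:E)%E.

(* A supremum in R: the set is nonempty and bounded under the Lyapunov
   hypotheses of the theorem. *)
Definition outer_radius (V : S -> R) (K C0 lam : R) : R :=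
  sup [set r | exists x y : S, mdist x y = r /\
    ((K%:E <= drift_ratio V x y)%E \/ V x + V y <= 4 * C0 / lam)].

End Coupling.

Definition rho (R : realType) (S : pmetricType R) (V : S -> R) (a c eps : R)
    (x y : S) : R :=
  a * (0 < mdist x y)%R%:R + 1 - expR (- (c * mdist x y)) +
  eps * (V x + V y) * (0 < mdist x y)%R%:R.

(* Main.v *)
Require Import Defs.
From mathcomp Require Import all_boot all_order all_algebra.
From mathcomp Require Import all_classical all_reals all_analysis.
From HB Require Import structures.
From mathcomp Require Import measurable_realfun ring lra.
Import Order.TTheory GRing.Theory Num.Theory.
Import numFieldNormedType.Exports.
Local Open Scope classical_set_scope.
Local Open Scope ring_scope.

(** Write [r = d(x, y)], [W = V x + V y] and [g s = 1 - exp (- c s)], so that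
    for [r > 0] the function [rho] is [a + g r + eps W].

    The concave function [g] lies below its tangent at [r], and below a
    parabola to the left of [r] ([concave_exp_taylor]):
      [g s <= g r + e^(- c r) (c (s - r) - c^2/2 (s - r)^2 1_(s < r))].
    Taking [s = d(X, Y)] and integrating, while [V] is controlled by the
    Lyapunov condition through the marginal laws of the coupling, bounds
    [E rho(X, Y)] by ([coupled_rho_le])
      [a (1 - pi) + g r + e^(- c r) (c beta - c^2 alpha)
         + eps ((1 - lam) W + 2 C0)].
    Only [2 eps C0] and a positive [beta] can push this above [rho(x, y)], and
    in each of three ranges of [r] one term pays for them:
    - for [0 < r <= r0], the jump [a pi] at distance zero, by the choice of
      [a] ([decrement_small]);
    - for [r0 < r <= r1], the curvature term [c^2 alpha], which by the choice
      of [c] absorbs [c beta] twice over and by the choice of [eps] leaves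
      [4 eps C0] ([decrement_middle]);
    - for [r > r1], the Lyapunov term [eps lam W]: there [W > 4 C0 / lam] and
      [beta < K W], and the part [A] of [c] makes [c K e^(- c r1) W] smaller
      than what is left of [eps lam W] ([decrement_large]).
    In the three ranges the decrement is at least the same quantity
    [C0 eps / c + (lam eps / 4 c) W], affine in [W] with positive
    coefficients, hence at least a fixed fraction of
    [rho(x, y) <= a + 1 + eps W] ([decrement_contraction]). On the diagonal
    both sides vanish, because the coupled points stay together.

    That [r1] delimits the third range rests on the two limits at infinity, which
    make the set defining [r1] bounded ([beyond_outer_radius]). *)

(** * Second-order bounds for the exponential *)

(** The partial sum of order three of the exponential series, whose terms are
    nonnegative. *)
Lemma expR_ge1DxD2 {R : realType} (x : R) :
  0 <= x -> 1 + x + x ^+ 2 / 2 <= expR x.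
Proof.
move=> x0.
have -> : 1 + x + x ^+ 2 / 2 = series (exp_coeff x) 3.
  rewrite /series /= !big_nat_recl//= big_geq// /exp_coeff/=.
  by rewrite !expr1 expr0 addr0 !divr1; ring.
apply: nondecreasing_cvgn_le; last exact: is_cvg_series_exp_coeff.
apply: nondecreasing_series => n _ _.
by rewrite /exp_coeff /= divr_ge0// exprn_ge0.
Qed.

(** With [u = c (r - s)] this is [1 + u + u^2/2 <= e^u] when [u > 0] and
    [1 + u <= e^u] otherwise, multiplied by [e^(- c r)]. The quadratic gain is
    lost for [s > r], since the cubic remainder changes sign at [r]: hence the
    indicator in the definition of [alpha]. *)
Lemma concave_exp_taylor {R : realType} (c r s : R) : 0 <= c ->
  1 - expR (- (c * s)) <= 1 - expR (- (c * r)) + expR (- (c * r)) *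
    (c * (s - r) - c ^+ 2 * (2^-1 * ((s - r) ^+ 2 * (s < r)%R%:R))).
Proof.
move=> c0.
have -> : expR (- (c * s)) = expR (- (c * r)) * expR (c * (r - s)).
  by rewrite -expRD; congr expR; ring.
set e := expR (- (c * r)); have e0 : 0 < e by exact: expR_gt0.
have H : 1 + c * (r - s) + c ^+ 2 * (2^-1 * ((s - r) ^+ 2 * (s < r)%R%:R))
    <= expR (c * (r - s)).
  case: ltP => [sr|rs]; rewrite ?mulr1 ?mulr0 ?addr0; last exact: expR_ge1Dx.
  have -> : c ^+ 2 * (2^-1 * (s - r) ^+ 2) = (c * (r - s)) ^+ 2 / 2.
    by field.
  by apply: expR_ge1DxD2; rewrite mulr_ge0// subr_ge0 ltW.
move: H; rewrite -(ler_pM2l e0) => H.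
lra.
Qed.

(** * Measurability of the distance *)

Lemma open_mdist_lt {R : realType} {S : metricType R} (q : S) (t : R) :
  open [set y : S | mdist q y < t].
Proof.
rewrite openE => y /= qyt; apply/nbhs_ballP; exists (t - mdist q y) => /=.
  by rewrite subr_gt0.
move=> z; rewrite ballEmdist /= => yz.
by apply: le_lt_trans (metric_triangle q y z) _; lra.
Qed.

Lemma measurable_mdistr {R : realType} {S : pmetricType R} (q : S) :
  measurable_fun [set: borel S] (fun y : borel S => mdist q (y : S)).
Proof.
move=> _.
apply: (measurability _ (RGenInftyO.measurableE R)) => //.
move=> _ [_ [t ->] <-]; rewrite setTI; apply: sub_sigma_algebra.
rewrite (_ : _ @^-1` _ = [set y : S | mdist q y < t]); first exact: open_mdist_lt.
by apply/seteqP; split => y; rewrite /= in_itv.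
Qed.

(** The distance is continuous on the product space, but only measurability for
    the product sigma-algebra is available, and there separability enters:
    [d(x, y) < t] holds exactly when [d(q, x) + d(q, y) < t] for some [q] in a
    countable dense set. *)
Lemma measurable_mdist {R : realType} {S : pmetricType R} {d : measure_display}
    {T : measurableType d} (X Y : T -> borel S) :
  separable_space S ->
  measurable_fun setT X -> measurable_fun setT Y ->
  measurable_fun setT (fun w => mdist (X w : S) (Y w : S)).
Proof.
move=> [D cD dD] mX mY.
have mZ (Z : T -> borel S) (q : S) : measurable_fun setT Z ->
    measurable_fun setT (fun w : T => mdist q (Z w : S)).
  by move=> mZ; exact: (measurableT_comp (measurable_mdistr q) mZ).
move=> _.
apply: (measurability _ (RGenInftyO.measurableE R)) => //.
move=> _ [_ [t ->] <-]; rewrite setTI.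
rewrite (_ : _ @^-1` _ = \bigcup_(q in D)
   [set w | (mdist q (X w : S) + mdist q (Y w : S) < t)%R]).
  rewrite bigcup_set_type; apply: countable_bigcupT_measurable.
    by rewrite (eq_countable (card_setT D)).
  move=> q; rewrite -[X in measurable X]setTI.
  have := measurable_funD (mZ _ (val q) mX) (mZ _ (val q) mY).
  by move=> /(_ measurableT _ (measurable_itv `]-oo, t[)); rewrite set_itvE.
apply/seteqP; split => [w|w [q Dq] /=]; rewrite /= in_itv /=; last first.
  by apply: le_lt_trans; rewrite (metric_sym q (X w)) metric_triangle.
move=> XYt.
pose e := (t - mdist (X w : S) (Y w : S)) / 2.
have [|q [/= Xq Dq]] := dD [set q : S | mdist (X w : S) q < e] _ (open_mdist_lt _ _).
  by exists (X w) => /=; rewrite mdistxx /e divr_gt0 ?subr_gt0.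
exists q => //=; move: Xq; rewrite metric_sym /e => Xq.
by have := metric_triangle q (X w : S) (Y w); lra.
Qed.

(** * The one-step estimate for a random distance *)

Section OneStep.
Context {R : realType} {d : measure_display} {T : measurableType d}.
Variable mu : probability T R.

Lemma Rintegral_probability_cst (k : R) : \int[mu]_w k = k.
Proof.
rewrite Rintegral_cst// [X in fine X](_ : _ = 1%E) ?mulr1//.
exact: probability_setT.
Qed.

Lemma bounded_integrable (f : T -> R) (M : R) :
  measurable_fun setT f -> (forall w, `|f w| <= M) ->
  mu.-integrable setT (EFin \o f).
Proof.
move=> mf fM; have iM := finite_measure_integrable_cst mu M measurableT.
apply: (le_integrable measurableT) iM.
  exact/measurable_EFinP.
by move=> w _ /=; rewrite lee_fin (le_trans (fM w)) ?ler_norm.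
Qed.

(** Integrals here are differences of the integrals of the positive and negative
    parts: a lower bound makes the latter finite, and an integral below [+oo]
    then makes the former finite. *)
Lemma lower_bounded_integrable (f : T -> R) (M : R) :
  measurable_fun setT f -> (forall w, - M <= f w) ->
  (\int[mu]_w (f w)%:E < +oo)%E -> mu.-integrable setT (EFin \o f).
Proof.
move=> mf fM.
have iM : mu.-integrable setT (EFin \o cst `|M|).
  exact: finite_measure_integrable_cst.
have : (\int[mu]_w (EFin \o f)^\- w < +oo)%E.
  apply: le_lt_trans (integrable_lty measurableT iM).
  apply: ge0_le_integral => //.
    by apply: measurable_funeneg; exact/measurable_EFinP.
    exact: measurable_int iM.
  move=> w _ /=; rewrite funenegE -EFin_max lee_fin ge_max normr_ge0.
  by rewrite andbT (le_trans _ (ler_norm M))// lerNl.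
set n := (X in (X < _)%E) => ny fy.
have n0 : (0 <= n)%E by exact: integral_ge0.
apply/integrableP; split; first exact/measurable_EFinP.
rewrite integral_fin_num_abs// fin_numE -ltey fy andbT integralE -/n.
have : (0 <= \int[mu]_w (EFin \o f)^\+ w)%E by exact: integral_ge0.
by rewrite -/(EFin \o f); move: n0 ny; case: n => // ? _ _; case: (integral _ _ _).
Qed.

(* [D] stands for the distance after one step and [U] for the Lyapunov mass. *)
Variables (D U : T -> R).
Hypotheses (mD : measurable_fun setT D) (D0 : forall w, 0 <= D w).
Hypotheses (mU : measurable_fun setT U) (U0 : forall w, 0 <= U w).

Lemma measurable_sqr_below (r : R) : measurable_fun setT
  (fun w => (D w - r) ^+ 2 * (D w < r)%R%:R).
Proof.
have mDr : measurable_fun setT (fun w => D w < r) by exact: measurable_fun_ltr.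
apply: measurable_funM.
  by apply: measurable_funX; exact: measurable_funB.
rewrite (_ : (fun w => _) = (fun w => if D w < r then 1 else 0)).
  exact: measurable_fun_ifT.
by apply/funext => w; case: ifP.
Qed.

Lemma measurable_pos : measurable_fun setT (fun w => (0 < D w)%R%:R : R).
Proof.
rewrite (_ : (fun w => _) = (fun w => if 0 < D w then 1 else 0)).
  by apply: measurable_fun_ifT => //; exact: measurable_fun_ltr.
by apply/funext => w; case: ifP.
Qed.

Lemma measurable_rho_of_dist (a c eps : R) : measurable_fun setT
  (fun w => a * (0 < D w)%R%:R + 1 - expR (- (c * D w)) +
     eps * U w * (0 < D w)%R%:R).
Proof.
have mpos := measurable_pos.
apply: measurable_funD.
  apply: measurable_funB.
    by apply: measurable_funD => //; exact: measurable_funM.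
  apply: measurableT_comp => //; apply: measurableT_comp => //.
  exact: measurable_funM.
by apply: measurable_funM => //; exact: measurable_funM.
Qed.

Lemma sqr_below_integrable (r : R) : mu.-integrable setT
  (fun w => ((D w - r) ^+ 2 * (D w < r)%R%:R)%:E).
Proof.
apply: (@bounded_integrable _ (r ^+ 2)); first exact: measurable_sqr_below.
move=> w; rewrite ger0_norm; last by rewrite mulr_ge0 ?sqr_ge0.
have := D0 w; case: ltP => ? ?; rewrite ?mulr1 ?mulr0 ?sqr_ge0//.
by rewrite -sqrrN opprB ler_pXn2r// ?nnegrE; lra.
Qed.

(** The integral of [concave_exp_taylor] at [s = D w]. The indicator of [D > 0]
    in front of [eps U] is dropped, while in front of [a] it integrates to
    [1 - mu (D = 0)]. *)
Lemma expectation_rho_le (r a c eps : R) : 0 <= a -> 0 <= c -> 0 <= eps ->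
  mu.-integrable setT (EFin \o D) -> mu.-integrable setT (EFin \o U) ->
  (\int[mu]_w (a * (0 < D w)%R%:R + 1 - expR (- (c * D w)) +
     eps * U w * (0 < D w)%R%:R)%:E <=
   (a * (1 - fine (mu [set w | D w = 0])) + (1 - expR (- (c * r))) +
    expR (- (c * r)) * (c * \int[mu]_w (D w - r) -
      c ^+ 2 * (2^-1 * \int[mu]_w ((D w - r) ^+ 2 * (D w < r)%R%:R))) +
    eps * \int[mu]_w U w)%:E)%E.
Proof.
move=> a0 c0 e0 iD iU.
pose pos w : R := (0 < D w)%R%:R.
have mpos : measurable_fun setT pos by exact: measurable_pos.
have ipos : mu.-integrable setT (EFin \o pos).
  apply: (@bounded_integrable _ 1) => // w.
  by rewrite /pos; case: ltP; rewrite ?normr1 ?normr0.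
have icst k : mu.-integrable setT (EFin \o cst k).
  exact: finite_measure_integrable_cst.
have iDr : mu.-integrable setT (fun w => (D w - r)%:E).
  exact: (integrableB measurableT iD (icst r)).
have iZ k f : mu.-integrable setT (EFin \o f) ->
    mu.-integrable setT (fun w => (k * f w)%:E).
  by move=> h; exact: (integrableZl measurableT k h).
have iDD f g : mu.-integrable setT (EFin \o f) ->
    mu.-integrable setT (EFin \o g) ->
    mu.-integrable setT (fun w => (f w + g w)%:E).
  by move=> h h'; exact: (integrableD measurableT h h').
have iBB f g : mu.-integrable setT (EFin \o f) ->
    mu.-integrable setT (EFin \o g) ->
    mu.-integrable setT (fun w => (f w - g w)%:E).
  by move=> h h'; exact: (integrableB measurableT h h').
pose q w := (D w - r) ^+ 2 * (D w < r)%R%:R.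
have iq : mu.-integrable setT (EFin \o q) by exact: sqr_below_integrable.
set e := expR (- (c * r)); have e1 : 0 < e by exact: expR_gt0.
have Epos : \int[mu]_w pos w = 1 - fine (mu [set w | D w = 0]).
  have mz : measurable [set w | D w = 0].
    by rewrite -[X in measurable X]setTI; exact: (mD measurableT [set 0]).
  rewrite (_ : pos = fun w => 1 - \1_[set w | D w = 0] w).
    rewrite RintegralB//; [|exact: icst|exact: integrable_indic].
    rewrite Rintegral_probability_cst; congr (_ - _).
    by rewrite /Rintegral integral_indic// setIT.
  apply/funext => w; rewrite /pos indicE; have := D0 w; rewrite le_eqVlt.
  case/predU1P => [Dw|Dw]; first by rewrite -Dw ltxx mem_set ?subrr.
  by rewrite Dw memNset ?subr0//= => Dw0; rewrite Dw0 ltxx in Dw.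
have i1 := iZ a _ ipos.
have i2 := iBB _ _ (iZ c _ iDr) (iZ (c ^+ 2) _ (iZ 2^-1 _ iq)).
have i3 := iDD _ _ (iDD _ _ i1 (icst (1 - e))) (iZ e _ i2).
have i4 := iZ eps _ iU.
have i5 := iDD _ _ i3 i4.
rewrite -Epos -(Rintegral_probability_cst (1 - e)).
rewrite -(RintegralZl _ measurableT ipos) -(RintegralZl _ measurableT iDr).
rewrite -(RintegralZl _ measurableT iq) -(RintegralZl _ measurableT (iZ _ _ iq)).
rewrite -(RintegralZl _ measurableT iU).
rewrite -(RintegralB measurableT (iZ _ _ iDr) (iZ _ _ (iZ _ _ iq))).
rewrite -(RintegralZl _ measurableT i2).
rewrite -(RintegralD measurableT i1 (icst _)).
rewrite -(RintegralD measurableT (iDD _ _ i1 (icst _)) (iZ _ _ i2)).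
rewrite -(RintegralD measurableT i3 i4).
rewrite fineK; last exact: integrable_fin_num.
apply: ge0_le_integral => //.
- move=> w _; rewrite lee_fin addr_ge0//; last by rewrite !mulr_ge0.
  rewrite -addrA addr_ge0 ?mulr_ge0// subr_ge0 -expR0 ler_expR oppr_le0.
  by rewrite mulr_ge0.
- by apply/measurable_EFinP; exact: measurable_rho_of_dist.
- by case/integrableP: i5.
move=> w _; rewrite lee_fin /=.
have T1 := concave_exp_taylor c r (D w) c0.
have T2 : eps * U w * (0 < D w)%R%:R <= eps * U w.
  by rewrite ler_piMr ?mulr_ge0//; case: ltP.
move: T1 T2; rewrite /= -/e -/(pos w) -/(q w); lra.
Qed.

End OneStep.

(** * Infima and suprema over attained distances *)

Section Attained.
Context {R : realType} {S : pmetricType R}.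
Implicit Types (f : S -> S -> \bar R) (I : set R) (g : R -> \bar R).
Local Open Scope ereal_scope.

Lemma level_inf_le f (x y : S) : level_inf f (mdist x y) <= f x y.
Proof. by apply: ereal_inf_lbound; exists x, y. Qed.

Lemma le_level_sup f (x y : S) : f x y <= level_sup f (mdist x y).
Proof. by apply: ereal_sup_ubound; exists x, y. Qed.

Lemma inf_attained_le I g (x y : S) :
  I (mdist x y) -> inf_attained S I g <= g (mdist x y).
Proof.
move=> Ixy; rewrite /inf_attained; case: asboolP => [I0|_].
  have : (I `&` distances S) (mdist x y) by split=> //; exists x, y.
  by rewrite I0.
by apply: ereal_inf_lbound; exists (mdist x y) => //; split=> //; exists x, y.
Qed.

Lemma le_sup_attained I g (x y : S) :
  I (mdist x y) -> g (mdist x y) <= sup_attained S I g.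
Proof.
move=> Ixy; rewrite /sup_attained; case: asboolP => [I0|_].
  have : (I `&` distances S) (mdist x y) by split=> //; exists x, y.
  by rewrite I0.
by apply: ereal_sup_ubound; exists (mdist x y) => //; split=> //; exists x, y.
Qed.

Lemma sup_attained_le I g (B : \bar R) : 0 <= B ->
  (forall x y : S, I (mdist x y) -> g (mdist x y) <= B) ->
  sup_attained S I g <= B.
Proof.
move=> B0 gB; rewrite /sup_attained; case: asboolP => [//|_].
by apply: ge_ereal_sup => _ [r [Ir [x [y xyr]]] <-]; subst r; exact: gB.
Qed.

Lemma sup_attained_ge0 I g :
  (forall x y : S, I (mdist x y) -> 0 <= g (mdist x y)) ->
  0 <= sup_attained S I g.
Proof.
move=> g0; rewrite /sup_attained; case: asboolP => [//|/eqP/set0P].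
move=> [r [Ir [x [y xyr]]]]; subst r.
apply: le_trans (g0 x y Ir) _; apply: ereal_sup_ubound.
by exists (mdist x y) => //; split=> //; exists x, y.
Qed.

(** Either the infimum is over the empty set and equals [1], or it is at most one
    of the values of [f]. *)
Lemma inf_attained_fin_num I f : 0 < inf_attained S I (level_inf f) ->
  (forall x y, f x y < +oo) -> inf_attained S I (level_inf f) \is a fin_num.
Proof.
move=> i0 fy; rewrite gt0_fin_numE// /inf_attained; case: asboolP => [_|/eqP/set0P].
  exact: ltry.
move=> [r [Ir [x [y xyr]]]]; subst r; apply: le_lt_trans (fy x y).
apply: le_trans (level_inf_le f x y); apply: ereal_inf_lbound.
by exists (mdist x y) => //; split=> //; exists x, y.
Qed.

Lemma near_distancesP (Q : R -> Prop) :
  (\forall r \near within (distances S) (pinfty_nbhs R), Q r) ->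
  exists M : R, forall x y : S, (M < mdist x y)%R -> Q (mdist x y).
Proof.
move=> [M [_ MQ]]; exists M => x y Mxy; apply: MQ => //.
by exists x, y.
Qed.

End Attained.

(** * The decrement in the three ranges of distances *)

(** Below, [p], [b] and [al] stand for [pi], [beta] and [alpha] at [(x, y)], [g]
    and [e] for [1 - e^(- c r)] and [e^(- c r)]; [ip] is the infimum of [pi] and
    [B] the supremum of the positive part of [beta] up to [r0], [ia] is the
    infimum of [alpha] from [r0] to [r1], and [e1] is [e^(- c r1)]. *)
Section Arithmetic.
Context {R : realType}.
Implicit Types a c eps lam K W : R.

Lemma eps_gt0 {c eps} {C0 e1 ia : R} : 1 <= c -> 0 < C0 -> 0 < e1 -> 0 < ia ->
  eps = (8 * C0)^-1 * c ^+ 2 * e1 * ia -> 0 < eps.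
Proof.
move=> c1 C0_gt0 e1_gt0 ia_gt0 ->.
by rewrite !mulr_gt0// ?invr_gt0 ?mulr_gt0 ?exprn_gt0//; lra.
Qed.

Lemma decrement_le {c eps W} (C0 lam : R) :
  1 <= c -> 0 < C0 -> 0 < lam -> 0 < eps -> 0 <= W ->
  C0 * eps / c + lam * eps / (4 * c) * W <= C0 * eps + lam * eps * W.
Proof.
move=> c1 C0_gt0 lam0 eps0 W0.
have cV1 : c^-1 <= 1 by rewrite invf_le1//; lra.
have cV0 : 0 < c^-1 by rewrite invr_gt0; lra.
apply: lerD; first by rewrite ler_piMr// mulr_ge0//; lra.
by apply: ler_wpM2r => //; rewrite ler_piMr ?mulr_ge0//; lra.
Qed.

(** As [a p] is at least twice [c B + 2 eps C0], it covers the growth [c B] of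
    the distance term and the Lyapunov constant [2 eps C0], and leaves as much
    again. *)
Lemma decrement_small {a c eps lam} {C0 e1 ia ip B p b al e g W : R} :
  1 <= c -> 0 < C0 -> 0 < lam < 1 -> 0 < e1 -> 0 < ia ->
  eps = (8 * C0)^-1 * c ^+ 2 * e1 * ia ->
  a = 2 * (c * B + 2 * eps * C0) * ip^-1 ->
  0 < ip -> ip <= p -> 0 <= B -> b <= B -> 0 <= al -> 0 < e -> e <= 1 ->
  0 <= W ->
  a * (1 - p) + g + e * (c * b - c ^+ 2 * al) + eps * ((1 - lam) * W + 2 * C0) <=
  a + g + eps * W - (C0 * eps / c + lam * eps / (4 * c) * W).
Proof.
move=> c1 C0_gt0 lam01 e1_gt0 ia_gt0 eps_def aE ip0 ipp B0 bB al0 e0 e_le1 W0.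
have eps0 := eps_gt0 c1 C0_gt0 e1_gt0 ia_gt0 eps_def.
have h1 : 2 * (c * B + 2 * eps * C0) <= a * p.
  have -> : 2 * (c * B + 2 * eps * C0) = a * ip by rewrite aE mulfVK// gt_eqF.
  apply: ler_wpM2l => //; rewrite aE mulr_ge0 ?invr_ge0 ?(ltW ip0)//.
  by have := mulr_ge0 (le_trans ler01 c1) B0; have := mulr_gt0 eps0 C0_gt0; lra.
have h2 : e * (c * b - c ^+ 2 * al) <= c * B.
  apply: (@le_trans _ _ (e * (c * B))).
    apply: ler_wpM2l; first exact: ltW.
    have : c * b <= c * B by apply: ler_wpM2l => //; lra.
    by have := mulr_ge0 (sqr_ge0 c) al0; lra.
  rewrite ler_piMl// mulr_ge0//; lra.
have h4 := decrement_le C0 lam c1 C0_gt0 (proj1 (andP lam01)) eps0 W0.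
have := mulr_gt0 eps0 C0_gt0.
have := mulr_ge0 (le_trans ler01 c1) B0.
lra.
Qed.

(** [2 b <= (c - 1) al] gives [c b - c^2 al <= - c^2 al / 2], and
    [e c^2 al / 2 >= e1 c^2 ia / 2 = 4 C0 eps] by the definition of [eps]:
    twice the Lyapunov constant [2 eps C0]. *)
Lemma decrement_middle {a c eps lam} {C0 e1 ia p b al e g W : R} :
  1 <= c -> 0 < C0 -> 0 < lam < 1 -> 0 < e1 -> 0 < ia ->
  eps = (8 * C0)^-1 * c ^+ 2 * e1 * ia ->
  0 <= a -> 0 <= p -> 2 * b <= (c - 1) * al -> ia <= al -> e1 <= e ->
  0 <= W ->
  a * (1 - p) + g + e * (c * b - c ^+ 2 * al) + eps * ((1 - lam) * W + 2 * C0) <=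
  a + g + eps * W - (C0 * eps / c + lam * eps / (4 * c) * W).
Proof.
move=> c1 C0_gt0 lam01 e1_gt0 ia_gt0 eps_def.
move=> a0 p0 bal aal ee W0.
have eps0 := eps_gt0 c1 C0_gt0 e1_gt0 ia_gt0 eps_def.
have h1 : 0 <= a * p by exact: mulr_ge0.
have epsE : c ^+ 2 * e1 * ia = 8 * C0 * eps.
  by rewrite eps_def; field; rewrite gt_eqF.
have h2 : e * (c * b - c ^+ 2 * al) <= - (4 * C0 * eps).
  apply: (@le_trans _ _ (- (c ^+ 2 / 2 * (e * al)))).
    rewrite (_ : c * b - _ = c * (b - c * al)); last by ring.
    rewrite (_ : - (_ / 2 * _) = e * (c * (c / 2 * - al))); last by field.
    by apply: ler_wpM2l; [lra|apply: ler_wpM2l; lra].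
  rewrite lerN2 (_ : 4 * C0 * eps = c ^+ 2 / 2 * (e1 * ia)); last by lra.
  apply: ler_wpM2l; first by rewrite divr_ge0 ?sqr_ge0.
  by apply: ler_pM => //; lra.
have h4 := decrement_le C0 lam c1 C0_gt0 (proj1 (andP lam01)) eps0 W0.
have := mulr_gt0 eps0 C0_gt0.
lra.
Qed.

(** Since [W > 4 C0 / lam], half of [eps lam W] pays for [2 eps C0]. The other
    half pays for the growth of the distance term: by the definition of [eps]
    and the first bound on [c], [c e1 K W] is at most
    [(1 - 1/c) eps lam W / 2]. The surplus [eps lam W / (2 c)] is the decrement,
    half of it being at least [C0 eps / c]. *)
Lemma decrement_large {a c eps lam K} {C0 e1 ia p b al e g W : R} :
  1 <= c -> 0 < C0 -> 0 < lam < 1 -> 0 < e1 -> 0 < ia ->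
  eps = (8 * C0)^-1 * c ^+ 2 * e1 * ia ->
  0 < K ->
  16 * K * C0 / (lam * ia) <= c - 1 ->
  0 <= a -> 0 <= p -> b <= K * W -> 0 <= al -> 0 < e -> e <= e1 ->
  4 * C0 / lam < W  ->
  a * (1 - p) + g + e * (c * b - c ^+ 2 * al) + eps * ((1 - lam) * W + 2 * C0) <=
  a + g + eps * W - (C0 * eps / c + lam * eps / (4 * c) * W).
Proof.
move=> c1 C0_gt0 lam01 e1_gt0 ia_gt0 eps_def K0.
move=> Ac a0 p0 bK al0 e0 ee WV.
have eps0 := eps_gt0 c1 C0_gt0 e1_gt0 ia_gt0 eps_def.
have h1 : 0 <= a * p by exact: mulr_ge0.
have WC : 4 * C0 < lam * W by rewrite -ltr_pdivrMl// 1?mulrC//; lra.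
have W0 : 0 < W by rewrite (lt_trans _ WV)// divr_gt0 ?mulr_gt0//; lra.
have KW : 0 <= K * W by rewrite mulr_ge0// ltW.
have h2 : e * (c * b - c ^+ 2 * al) <= c * e1 * K * W.
  apply: (@le_trans _ _ (e * (c * (K * W)))).
    apply: ler_wpM2l; first exact: ltW.
    have : c * b <= c * (K * W) by apply: ler_wpM2l => //; lra.
    by have := mulr_ge0 (sqr_ge0 c) al0; lra.
  rewrite -!mulrA mulrCA; apply: ler_wpM2l; first lra.
  exact: ler_wpM2r.
have cn0 : c != 0 by rewrite gt_eqF//; lra.
have KE : c * e1 * K = 16 * K * C0 / (lam * ia) * (lam * eps / (2 * c)).
  rewrite eps_def; field; rewrite cn0 !gt_eqF//=; lra.
have h6 : c * e1 * K <= (c - 1) * (lam * eps / (2 * c)).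
  by rewrite KE; apply: ler_wpM2r => //; rewrite divr_ge0 ?mulr_ge0//; lra.
have h7 : (c - 1) * (lam * eps / (2 * c)) =
    lam * eps / 2 - 2 * (lam * eps / (4 * c)).
  by field.
rewrite h7 in h6; have h8 := ler_wpM2r (ltW W0) h6.
have cV0 : 0 < c^-1 by rewrite invr_gt0; lra.
have h4 : C0 * eps / c <= lam * eps / (4 * c) * W.
  rewrite (_ : _ * W = lam * W * (eps / (4 * c))); last by ring.
  rewrite (_ : C0 * _ / _ = 4 * C0 * (eps / (4 * c))); last by field.
  by apply: ler_wpM2r (ltW WC); rewrite divr_ge0//; lra.
have h9 : eps * (lam * W) >= eps * (4 * C0) by apply: ler_wpM2l; lra.
lra.
Qed.

(** The comparison is made separately on the terms free of [W], where
    [g <= 1], and on those with [W]; each of the two bounds on [cstar] is the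
    ratio needed in one of them. *)
Lemma decrement_contraction {a c eps lam} {C0 cstar g W : R} :
  0 <= a -> 0 < eps -> g <= 1 -> 0 <= W -> 0 <= cstar ->
  cstar <= C0 * eps / c / (a + 1) -> cstar <= lam / (4 * c) ->
  cstar * (a + g + eps * W) <= C0 * eps / c + lam * eps / (4 * c) * W.
Proof.
move=> a0 eps0 g1 W0 cs0 cs1 cs2; rewrite mulrDr; apply: lerD.
  apply: (@le_trans _ _ (cstar * (a + 1))).
    by apply: ler_wpM2l => //; lra.
  by rewrite -ler_pdivlMr//; lra.
rewrite (_ : lam * eps / _ * W = lam / (4 * c) * (eps * W)); last by ring.
by apply: ler_wpM2r; rewrite // mulr_ge0// ltW.
Qed.

End Arithmetic.

(** * The one-step estimate for a coupling *)

Lemma ge0_integral_law {R : realType} {d1 d2 : measure_display}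
    {T1 : measurableType d1} {T2 : measurableType d2}
    (mu : {measure set T1 -> \bar R}) (nu : {measure set T2 -> \bar R})
    (X : {mfun T1 >-> T2}) (f : T2 -> R) :
  (forall B, measurable B -> pushforward mu X B = nu B) ->
  measurable_fun setT f -> (forall z, 0 <= f z) ->
  (\int[mu]_w (f (X w))%:E = \int[nu]_z (f z)%:E)%E.
Proof.
move=> law mf f0.
rewrite -(@eq_measure_integral _ _ _ setT nu (pushforward mu X)); last first.
  by move=> B mB _; exact: law.
rewrite [RHS]ge0_integral_pushforward//; first exact/measurable_EFinP.
by move=> z _; rewrite lee_fin.
Qed.

(** The values of a probability kernel are typed as mere measures. Taking the
    record apart lets the rest of the structure be attached to the same
    function. *)
Lemma measure_is_probability {R : realType} {d : measure_display}
    {T : measurableType d} (mu : {measure set T -> \bar R}) :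
  mu setT = 1%E ->
  exists Q : probability T R, mu = Q :> {measure set T -> \bar R}.
Proof.
case: mu => f cf mu1.
pose Q : probability T R :=
  HB.pack f cf (Measure_isProbability.Build _ _ _ (Measure.Pack cf) mu1).
by exists Q; exact: eq_measure.
Qed.

Section CoupledStep.
Context {R : realType} {S : pmetricType R} {d : measure_display}
  {Omega : measurableType d}.
Variables (P : R.-pker (borel S * borel S) ~> Omega)
  (X Y : {mfun Omega >-> borel S}) (p : R.-pker (borel S) ~> (borel S)).
Variables (V : borel S -> R) (C0 lam : R).
Hypotheses (hS : separable_space S) (hcoupling : markov_coupling P X Y p)
  (hVmeas : measurable_fun [set: borel S] V) (hVge0 : forall x : S, 0 <= V x)
  (hLyapunov : forall x : S,
      (\int[p x]_z (V z)%:E <= ((1 - lam) * V x + C0)%R%:E)%E).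

Let Dist w : R := mdist (X w : S) (Y w : S).
Let U w : R := V (X w) + V (Y w).

Let mD : measurable_fun setT Dist.
Proof. exact: measurable_mdist. Qed.

Let mz : measurable [set w | Dist w = 0].
Proof. by rewrite -[X in measurable X]setTI; exact: (mD measurableT [set 0]). Qed.

Let mVX : measurable_fun setT (fun w => V (X w)).
Proof. exact: measurableT_comp. Qed.

Let mVY : measurable_fun setT (fun w => V (Y w)).
Proof. exact: measurableT_comp. Qed.

Let mU : measurable_fun setT U.
Proof. exact: measurable_funD. Qed.

Lemma coupled_lyapunov (x y : S) : (\int[P (x, y)]_w (U w)%:E <=
  ((1 - lam) * (V x + V y) + 2 * C0)%:E)%E.
Proof.
rewrite /U; under eq_integral do rewrite EFinD.
rewrite ge0_integralD//=.
- rewrite (ge0_integral_law _ (p x))//; last first.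
    by move=> B mB; have [] := hcoupling x y B mB.
  rewrite (ge0_integral_law _ (p y))//; last first.
    by move=> B mB; have [] := hcoupling x y B mB.
  apply: le_trans (leeD (hLyapunov x) (hLyapunov y)) _.
  by rewrite -EFinD lee_fin; lra.
all: by [move=> w _; rewrite lee_fin; exact: hVge0 | exact/measurable_EFinP].
Qed.

(** The extended-real quantities of the coupling become real here: [d(X, Y)] is
    integrable because [beta] is not [+oo], and [alpha] is at most
    [d(x, y)^2 / 2]. *)
Lemma coupled_rho_le (x y : S) (a c eps : R) :
  0 <= a -> 0 <= c -> 0 <= eps -> (beta P X Y x y < +oo)%E ->
  exists b al q : R,
  [/\ beta P X Y x y = b%:E, alpha P X Y x y = al%:E, pi_ P X Y x y = q%:E,
      0 <= al & 0 <= q] /\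
  (\int[P (x, y)]_w (rho V a c eps (X w) (Y w))%:E <=
   (a * (1 - q) + (1 - expR (- (c * mdist x y))) +
    expR (- (c * mdist x y)) * (c * b - c ^+ 2 * al) +
    eps * ((1 - lam) * (V x + V y) + 2 * C0))%:E)%E.
Proof.
move=> a0 c0 e0; have := coupled_lyapunov x y; rewrite /beta /alpha /pi_.
have [Q ->] := measure_is_probability (P (x, y)) (@prob_kernel _ _ _ _ _ P (x, y)).
move=> QU beta_lty.
have D0 w : 0 <= Dist w by exact: mdist_ge0.
have U0 w : 0 <= U w by rewrite addr_ge0// hVge0.
set r := mdist x y in beta_lty *.
have iDr : Q.-integrable setT (fun w => (Dist w - r)%:E).
  apply: (@lower_bounded_integrable _ _ _ Q _ r) => //.
    exact: measurable_funB.
  by move=> w; have := D0 w; lra.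
have iD : Q.-integrable setT (EFin \o Dist).
  rewrite (_ : EFin \o Dist = (fun w => (Dist w - r)%:E + (cst r w)%:E)%E).
    by apply: integrableD => //; exact: finite_measure_integrable_cst.
  by apply/funext => w /=; rewrite -EFinD subrK.
have iU : Q.-integrable setT (EFin \o U).
  apply: (@lower_bounded_integrable _ _ _ Q _ 0) => //.
    by move=> w; rewrite oppr0.
  exact: le_lt_trans QU (ltry _).
have iq := sqr_below_integrable Q Dist mD D0 r.
exists (\int[Q]_w (Dist w - r)),
  (2^-1 * \int[Q]_w ((Dist w - r) ^+ 2 * (Dist w < r)%R%:R)),
  (fine (Q [set w | Dist w = 0])); split; [split|].
- by rewrite fineK//; exact: integrable_fin_num.
- by rewrite EFinM fineK//; exact: integrable_fin_num.
- by rewrite fineK//; exact: fin_num_measure mz.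
- apply: mulr_ge0 => //; apply: Rintegral_ge0 => w _.
  by apply: mulr_ge0 => //; exact: sqr_ge0.
- by apply: fine_ge0; exact: measure_ge0.
apply: le_trans (expectation_rho_le Q Dist U mD D0 mU U0 r a c eps a0 c0 e0 iD iU) _.
rewrite lee_fin lerD2l; apply: ler_wpM2l => //.
by rewrite -lee_fin fineK//; exact: integrable_fin_num.
Qed.

Lemma coupled_rho_diag (x : S) (a c eps : R) :
  P (x, x) [set w | X w = Y w] = 1%E ->
  (\int[P (x, x)]_w (rho V a c eps (X w) (Y w))%:E = 0)%E.
Proof.
have [Q ->] := measure_is_probability (P (x, x)) (@prob_kernel _ _ _ _ _ P (x, x)).
have -> : [set w | X w = Y w] = [set w | Dist w = 0].
  apply/seteqP; split => w /=; first by rewrite /Dist => ->; rewrite mdistxx.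
  exact: mdist_positivity.
move=> Q1; rewrite (@ae_eq_integral _ _ _ Q setT (cst 0%E))//.
- by rewrite integral0.
- apply/measurable_EFinP; exact: (measurable_rho_of_dist Dist U mD mU a c eps).
exists (~` [set w | Dist w = 0]); split.
- exact: measurableC.
- by apply: etrans (probability_setC Q mz) _; rewrite Q1 subee.
apply: subsetC => w /= Dw _; congr EFin.
rewrite /rho -/(Dist w) Dw ltxx !mulr0 oppr0 expR0; lra.
Qed.

Lemma pi_lty (x y : S) : (pi_ P X Y x y < +oo)%E.
Proof.
rewrite /pi_; have [Q ->] :=
  measure_is_probability (P (x, y)) (@prob_kernel _ _ _ _ _ P (x, y)).
by rewrite -ge0_fin_numE//; exact: fin_num_measure mz.
Qed.

Lemma alpha_lty (x y : S) : (alpha P X Y x y < +oo)%E.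
Proof.
rewrite /alpha; have [Q ->] :=
  measure_is_probability (P (x, y)) (@prob_kernel _ _ _ _ _ P (x, y)).
have D0 w : 0 <= Dist w by exact: mdist_ge0.
have iq := sqr_below_integrable Q Dist mD D0 (mdist x y).
by rewrite ltey_eq fin_numM//; exact: integrable_fin_num iq.
Qed.

End CoupledStep.

(** * Beyond the outer radius *)

Section OuterRadius.
Context {R : realType} {S : pmetricType R} {d : measure_display}
  {Omega : measurableType d}.
Variables (P : R.-pker (borel S * borel S) ~> Omega)
  (X Y : {mfun Omega >-> borel S}).

Lemma drift_ratio_lt (V : S -> R) (K : R) (x y : S) : 0 < V x + V y ->
  (drift_ratio P X Y V x y < K%:E)%E ->
  (beta P X Y x y < (K * (V x + V y))%:E)%E.
Proof. by move=> W0; rewrite /drift_ratio inver gt_eqF// lte_pdivrMr. Qed.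

(** A point beyond the supremum of a set bounded above is not in the set. Both
    limits exclude large distances from the set: the first the sublevel
    condition on [V], the second the condition on the drift. Bounded distances
    need no separate treatment: the limits are then along the trivial filter,
    and every distance lies below some real number anyway. *)
Lemma beyond_outer_radius (V : S -> R) (K C0 lam : R) :
  level_inf (fun x y : S => (V x + V y)%R%:E) r
    @[r --> within (distances S) (pinfty_nbhs R)] --> +oo%E ->
  level_sup (drift_ratio P X Y V) r
    @[r --> within (distances S) (pinfty_nbhs R)] --> 0%E ->
  0 < K -> forall x y : S, outer_radius P X Y V K C0 lam < mdist x y ->
  (drift_ratio P X Y V x y < K%:E)%E /\ 4 * C0 / lam < V x + V y.
Proof.
move=> Vlim betalim K0.
have [M1 HM1] := near_distancesP _ (cvgey_gt Vlim (4 * C0 / lam)).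
have ltK : nbhs (0 : \bar R)%E [set e | (e < K%:E)%E].
  by apply: open_ereal_lt'; rewrite lte_fin.
have [M2 HM2] := near_distancesP _ (betalim _ ltK).
move=> x y xy; have {xy} Nxy : ~ ((K%:E <= drift_ratio P X Y V x y)%E \/
    V x + V y <= 4 * C0 / lam).
  move=> bad; move: xy; rewrite ltNge => /negP; apply.
  apply: ub_le_sup; last by exists x, y.
  exists (Num.max M1 M2) => _ [x' [y' [<- bad']]].
  rewrite leNgt; apply/negP; rewrite gt_max => /andP[xy1 xy2].
  case: bad'; apply/negP; rewrite -?ltNge.
    exact: le_lt_trans (le_level_sup _ _ _) (HM2 _ _ xy2).
  rewrite -lte_fin.
  exact: lt_le_trans (HM1 _ _ xy1) (level_inf_le _ _ _).
split; rewrite ltNge; apply/negP => h; apply: Nxy; by [left|right].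
Qed.

End OuterRadius.

(** * The contraction *)

Theorem theorem2p3 (R : realType) (S : pmetricType R) (hS : separable_space S)
    (p : R.-pker (borel S) ~> (borel S))
    (d : measure_display) (Omega : measurableType d)
    (P : R.-pker (borel S * borel S) ~> Omega)
    (X Y : {mfun Omega >-> borel S})
    (hcoupling : markov_coupling P X Y p)
    (hdiag : forall x : S, P (x, x) [set w | X w = Y w] = 1%E)
    (V : borel S -> R) (C0 lam : R)
    (hVmeas : measurable_fun [set: borel S] V)
    (hVge0 : forall x : S, 0 <= V x)
    (hC0 : 0 < C0) (hlam : 0 < lam < 1)
    (hLyapunov : forall x : S,
      (\int[p x]_z (V z)%:E <= ((1 - lam) * V x + C0)%R%:E)%E)
    (hVlim :
      level_inf (fun x y : S => (V x + V y)%R%:E) r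
        @[r --> within (distances S) (pinfty_nbhs R)] --> +oo%E)
    (hbetalim :
      level_sup (drift_ratio P X Y V) r
        @[r --> within (distances S) (pinfty_nbhs R)] --> 0%E)
    (K : R) (hK : 0 < K) (r0 : R) :
  let r1 := outer_radius P X Y V K C0 lam in
  0 < r0 <= r1 ->
  (0 < inf_attained S [set r | 0 < r <= r0]%R (pi_low P X Y))%E ->
  (0 < inf_attained S [set r | r0 < r <= r1]%R (alpha_low P X Y))%E ->
  (sup_attained S [set r | 0 < r <= r1]%R (beta_up P X Y) < +oo)%E ->
  let inf_pi :=
    fine (inf_attained S [set r | 0 < r <= r0] (pi_low P X Y)) in
  let inf_alpha :=
    fine (inf_attained S [set r | r0 < r <= r1] (alpha_low P X Y)) in
  let A := 16 * K * C0 / (lam * inf_alpha) in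
  let c := fine (sup_attained S [set r | r0 < r <= r1] (fun r =>
      (2%:E * beta_up_pos P X Y r / alpha_low P X Y r)%E)) + A + 1 in
  let eps := (8 * C0)^-1 * c ^+ 2 * expR (- (c * r1)) * inf_alpha in
  let a := 2 * (c * fine (sup_attained S [set r | 0 < r <= r0]
      (beta_up_pos P X Y)) + 2 * eps * C0) * inf_pi^-1 in
  exists2 cstar : R, 0 < cstar < 1 &
    forall x y : S,
      (\int[P (x, y)]_w (rho V a c eps (X w) (Y w))%:E
        <= ((1 - cstar) * rho V a c eps x y)%R%:E)%E.
Proof.
move=> r1 /andP[r0_gt0 r01] pi_gt0 al_gt0 beta_lty inf_pi inf_alpha A c eps a.
have [lam0 lam1] := andP hlam.
have alpha_lty' := alpha_lty P X Y hS.
have piE := fineK (inf_attained_fin_num _ _ pi_gt0 (pi_lty P X Y hS)).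
have alE := fineK (inf_attained_fin_num _ _ al_gt0 alpha_lty').
rewrite -/inf_pi in piE; rewrite -/inf_alpha in alE.
have inf_pi_gt0 : 0 < inf_pi by rewrite -lte_fin piE.
have inf_alpha_gt0 : 0 < inf_alpha by rewrite -lte_fin alE.
(* A real bound for the positive part of the drift, which makes the suprema in
   [a] and [c] real numbers; the supremum assumed below [+oo] may be negative. *)
have [B B0 leB] : exists2 B : R, 0 <= B & forall x y : S,
    0 < mdist x y <= r1 -> (beta_up_pos P X Y (mdist x y) <= B%:E)%E.
  pose b := maxe (sup_attained S [set r | 0 < r <= r1] (beta_up P X Y)) 0%E.
  have b0 : (0 <= b)%E by rewrite le_max lexx orbT.
  have bE : (fine b)%:E = b.
    by apply: fineK; rewrite ge0_fin_numE// /b gt_max beta_lty ltry.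
  exists (fine b); first exact: fine_ge0.
  move=> x y xy; rewrite bE ge_max b0 andbT le_max.
  by rewrite le_sup_attained.
have beta_le (x y : S) : (beta P X Y x y <= beta_up_pos P X Y (mdist x y))%E.
  by rewrite le_max le_level_sup.
have beta_up_pos_ge0 r : (0 <= beta_up_pos P X Y r)%E by rewrite le_max lexx orbT.
have beta_fin (x y : S) : 0 < mdist x y <= r1 -> (beta P X Y x y < +oo)%E.
  move=> xy; apply: le_lt_trans (beta_le x y) _.
  exact: le_lt_trans (leB _ _ xy) (ltry _).
have [supB supB0 le_supB] : exists2 supB : R, 0 <= supB &
    supB = fine (sup_attained S [set r | 0 < r <= r0] (beta_up_pos P X Y)) /\
    forall x y : S, 0 < mdist x y <= r0 -> (beta P X Y x y <= supB%:E)%E.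
  set s := sup_attained _ _ _.
  have s0 : (0 <= s)%E by apply: sup_attained_ge0 => *; exact: beta_up_pos_ge0.
  have sB : (s <= B%:E)%E.
    apply: sup_attained_le => // x y /andP[xy0 xyr]; apply: leB.
    by rewrite xy0 (le_trans xyr).
  exists (fine s); first exact: fine_ge0.
  split=> // x y xy; apply: le_trans (beta_le x y) _.
  rewrite fineK ?ge0_fin_numE//; last exact: le_lt_trans sB (ltry _).
  exact: le_sup_attained.
have {le_supB} [supBE le_supB] := le_supB.
pose ratio r := (2%:E * beta_up_pos P X Y r / alpha_low P X Y r)%E.
have ratioE (x y : S) : r0 < mdist x y <= r1 -> exists b al : R,
    [/\ beta_up_pos P X Y (mdist x y) = b%:E, 0 <= b, b <= B,
        alpha_low P X Y (mdist x y) = al%:E &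
        inf_alpha <= al] /\ ratio (mdist x y) = (2 * b / al)%:E.
  move=> xy; have xy' : 0 < mdist x y <= r1.
    by case/andP: xy => /(lt_trans r0_gt0) -> ->.
  have h1 := leB _ _ xy'; have h2 := beta_up_pos_ge0 (mdist x y).
  have h3 : (inf_alpha%:E <= alpha_low P X Y (mdist x y))%E.
    by rewrite alE; exact: inf_attained_le.
  have h4 : (alpha_low P X Y (mdist x y) < +oo)%E.
    exact: le_lt_trans (level_inf_le _ _ _) (alpha_lty' x y).
  rewrite /ratio; move: h1 h2 h3 h4.
  case: (beta_up_pos _ _ _ _) => [b| |]//; case: (alpha_low _ _ _ _) => [al| |]//.
  rewrite !lee_fin => h1 h2 h3 _; exists b, al; split=> //.
  by rewrite inver gt_eqF// (lt_le_trans inf_alpha_gt0).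
(* [alpha_low >= inf_alpha] keeps the quotients in [c] below [2 B / inf_alpha]. *)
have [M M0 [ME le_M]] : exists2 M : R, 0 <= M &
    M = fine (sup_attained S [set r | r0 < r <= r1] ratio) /\
    forall x y : S, r0 < mdist x y <= r1 -> (ratio (mdist x y) <= M%:E)%E.
  set s := sup_attained _ _ _.
  have s0 : (0 <= s)%E.
    apply: sup_attained_ge0 => x y /ratioE[b [al [[_ b0 _ _ al0] ->]]].
    by rewrite lee_fin divr_ge0 ?mulr_ge0// (le_trans (ltW inf_alpha_gt0)).
  have sB : (s <= (2 * B / inf_alpha)%:E)%E.
    apply: sup_attained_le.
      by rewrite lee_fin divr_ge0 ?mulr_ge0// ltW.
    move=> x y /ratioE[b [al [[_ b0 bB _ al0] ->]]].
    rewrite lee_fin ler_pM ?mulr_ge0 ?invr_ge0//.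
    - exact: le_trans (ltW inf_alpha_gt0) al0.
    - exact: ler_wpM2l.
    - by rewrite lef_pV2 ?posrE// (lt_le_trans inf_alpha_gt0).
  exists (fine s); first exact: fine_ge0.
  split=> // x y xy.
  rewrite fineK ?ge0_fin_numE//; last exact: le_lt_trans sB (ltry _).
  exact: le_sup_attained.
have A0 : 0 < A by rewrite divr_gt0 ?mulr_gt0.
have cE : c = M + A + 1 by rewrite /c -/ratio ME.
have c1 : 1 <= c by lra.
have e1_gt0 : 0 < expR (- (c * r1)) by exact: expR_gt0.
have epsE : eps = (8 * C0)^-1 * c ^+ 2 * expR (- (c * r1)) * inf_alpha by [].
have eps0 : 0 < eps by exact: eps_gt0 epsE.
have aE : a = 2 * (c * supB + 2 * eps * C0) * inf_pi^-1 by rewrite /a -supBE.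
clearbody eps a.
have a0 : 0 <= a.
  rewrite aE; apply: mulr_ge0; last by rewrite invr_ge0 ltW.
  apply: mulr_ge0 => //; apply: addr_ge0; apply: mulr_ge0 => //; lra.
pose cstar := Num.min (C0 * eps / c / (a + 1)) (lam / (4 * c)).
have cs0 : 0 < cstar.
  rewrite lt_min; apply/andP; split; rewrite !divr_gt0 ?mulr_gt0//; lra.
have cs1 : cstar < 1.
  rewrite gt_min; apply/orP; right.
  rewrite ltr_pdivrMr; lra.
exists cstar; first by rewrite cs0.
move=> x y; set r := mdist x y; set W := V x + V y.
have W0 : 0 <= W by rewrite addr_ge0.
have : 0 <= r by exact: mdist_ge0.
rewrite le_eqVlt => /predU1P[/esym/mdist_positivity <-|r_gt0].
  rewrite coupled_rho_diag// lee_fin /rho mdistxx ltxx !mulr0 oppr0 expR0.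
  by rewrite add0r addr0 subrr mulr0.
have rhoE : rho V a c eps x y = a + (1 - expR (- (c * r))) + eps * W.
  by rewrite /rho -/r r_gt0 !mulr1 addrA.
have er0 : 0 < expR (- (c * r)) by exact: expR_gt0.
have er1 : expR (- (c * r)) <= 1.
  by rewrite -expR0 ler_expR oppr_le0 mulr_ge0//; lra.
have from_decrement : (beta P X Y x y < +oo)%E ->
    (forall b al q : R, beta P X Y x y = b%:E -> alpha P X Y x y = al%:E ->
      pi_ P X Y x y = q%:E -> 0 <= al -> 0 <= q ->
      a * (1 - q) + (1 - expR (- (c * r))) +
      expR (- (c * r)) * (c * b - c ^+ 2 * al) +
      eps * ((1 - lam) * W + 2 * C0) <=
      a + (1 - expR (- (c * r))) + eps * W -
      (C0 * eps / c + lam * eps / (4 * c) * W)) ->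
    (\int[P (x, y)]_w (rho V a c eps (X w) (Y w))%:E
        <= ((1 - cstar) * rho V a c eps x y)%R%:E)%E.
  move=> bfin dec; have c0 : 0 <= c by lra.
  have [b [al [q [[bE alphaE qE al0 q0] bound]]]] :=
    coupled_rho_le P X Y p V C0 lam hS hcoupling hVmeas hVge0 hLyapunov
      x y a c eps a0 c0 (ltW eps0) bfin.
  apply: le_trans bound _; rewrite lee_fin.
  apply: le_trans (dec _ _ _ bE alphaE qE al0 q0) _.
  rewrite rhoE mulrBl mul1r lerD2l lerN2.
  apply: decrement_contraction => //; rewrite ?ge_min ?lexx ?orbT//; lra.
have [r_r0|r0_r] := leP r r0.
  have xy : 0 < mdist x y <= r0 by rewrite r_gt0.
  apply: from_decrement.
    by apply: le_lt_trans (le_supB _ _ xy) (ltry _).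
  move=> b al q bE alphaE qE al0 q0.
  apply: (decrement_small c1 hC0 hlam e1_gt0 inf_alpha_gt0 epsE aE) => //.
    rewrite -lee_fin piE -qE.
    apply: le_trans (level_inf_le _ x y); exact: inf_attained_le.
  by rewrite -lee_fin -bE; exact: le_supB.
have [r_r1|r1_r] := leP r r1.
  have xy : r0 < mdist x y <= r1 by rewrite r0_r.
  apply: from_decrement; first by apply: beta_fin; rewrite r_gt0.
  move=> b al q bE alphaE qE al0 q0.
  have [bu [alow [[buE bu0 _ alowE alow_ge] ratE]]] := ratioE _ _ xy.
  have alow0 : 0 < alow by exact: lt_le_trans alow_ge.
  have alow_le : alow <= al by rewrite -lee_fin -alowE -alphaE; exact: level_inf_le.
  apply: (decrement_middle c1 hC0 hlam e1_gt0 inf_alpha_gt0 epsE) => //.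
  - have := le_M _ _ xy; rewrite ratE lee_fin ler_pdivrMr// => h.
    have bbu : b <= bu by rewrite -lee_fin -bE -buE; exact: beta_le.
    have : M * alow <= (c - 1) * al by apply: ler_pM => //; lra.
    by lra.
  - exact: le_trans alow_le.
  - by rewrite ler_expR lerN2 ler_pM2l//; lra.
have [drift WV] := beyond_outer_radius P X Y _ _ _ _ hVlim hbetalim hK _ _ r1_r.
have W_gt0 : 0 < W by rewrite (lt_trans _ WV)// divr_gt0 ?mulr_gt0.
have bK := drift_ratio_lt P X Y V _ _ _ W_gt0 drift.
apply: from_decrement; first exact: lt_trans bK (ltry _).
move=> b al q bE alphaE qE al0 q0.
apply: (decrement_large c1 hC0 hlam e1_gt0 inf_alpha_gt0 epsE hK) => //.
- by rewrite -/A; lra.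
- by rewrite -lee_fin -bE ltW.
- rewrite ler_expR lerN2 ler_pM2l ?ltW//; lra.
Qed.
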